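(* Let $C\subset\mathbb{R}^n$ be nonempty, compact and convex, let $U\subset\mathbb{R}^n$ be open and convex with $C\cap U\neq\emptyset$, and let $f:U\to\mathbb{R}$ be twice continuously differentiable and convex. Assume boundary blow-up: for every $\alpha\in\mathbb{R}$ such that $L_\alpha:=\{p\in C\cap U\mid f(p)\le\alpha\}$ is nonempty, $\operatorname{dist}(L_\alpha,U^c)>0$. Let $p^{(0)}\in C\cap U$. Then the initial sublevel set $$\mathcal F^{(0)}:=\{p\in C\cap U\mid f(p)\le f(p^{(0)})\}$$ is nonempty, compact and convex, and $d:=\operatorname{dist}(\mathcal F^{(0)},U^c)>0$.
   Context: $U^c=\mathbb{R}^n\setminus U$ and $\operatorname{dist}(A,B)=\inf\{\|a-b\|: a\in A,b\in B\}$ (Euclidean norm), with the convention $\operatorname{dist}(A,\emptyset)=+\infty$. *)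

(* Defs.v *)
From HB Require Import structures.
From mathcomp Require Import all_boot all_order all_algebra.
From mathcomp Require Import all_classical all_reals all_analysis.

Set Implicit Arguments.
Unset Strict Implicit.
Unset Printing Implicit Defensive.

Import Order.TTheory GRing.Theory Num.Theory.
Import numFieldNormedType.Exports.

Local Open Scope classical_set_scope.
Local Open Scope ring_scope.

(* The library norm `|x| on 'rV[R]_n is the sup norm. It induces the same
   topology as the Euclidean norm but a different distance. *)
Definition enorm (R : realType) (n : nat) (x : 'rV[R]_n) : R :=
  Num.sqrt (\sum_(i < n) x 0 i ^+ 2).

(* \bar R-valued: since ereal_inf set0 = +oo, the distance to set0 is +oo. *)
Definition dist (R : realType) (n : nat) (A B : set 'rV[R]_n) : \bar R :=
  ereal_inf [set r : \bar R |
    exists a b, [/\ A a, B b & r = (enorm (a - b))%:E]].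

Definition gradient (R : realType) (n : nat) (f : 'rV[R]_n -> R)
    (x : 'rV[R]_n) : 'rV[R]_n :=
  \row_(i < n) 'D_(delta_mx 0 i) f x.

(* A function U -> R is represented by a total function; for U open all the
   conditions below depend only on its restriction to U. The Hessian is the
   Jacobian of the gradient. *)
Definition twice_continuously_differentiable (R : realType) (n : nat)
    (U : set 'rV[R]_n) (f : 'rV[R]_n -> R) : Prop :=
  forall x, U x ->
    [/\ differentiable f x,
        differentiable (gradient f) x &
        {for x, continuous (jacobian (gradient f))}].

Definition sublevel (R : realType) (n : nat) (C U : set 'rV[R]_n)
    (f : 'rV[R]_n -> R) (alpha : R) : set 'rV[R]_n :=
  [set p | (C `&` U) p /\ f p <= alpha].

(* Main.v *)
Require Import Defs.
From mathcomp Require Import all_boot all_order all_algebra.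
From mathcomp Require Import all_classical all_reals all_analysis.
Import Order.TTheory GRing.Theory Num.Theory.
Import numFieldNormedType.Exports.
Local Open Scope classical_set_scope.
Local Open Scope ring_scope.

(** A sublevel set sits inside the compact set [C]; what could fail for its
    compactness is closedness in the whole space, since [f] says nothing about boundary
    points of [U].  Boundary blow-up repairs this: a limit point of the
    sublevel set lies at distance zero from it, hence cannot belong to the
    complement of [U] ([closure_dist_gt0]).  It is therefore a point of [U],
    where [f] is continuous, so the inequality passes to the limit; it also
    lies in [C], which is closed.  The sublevel set is thus a closed subset of
    the compact set [C] ([closed_sublevel]).  Convexity follows from the
    convexity inequality and the monotonicity of averages
    ([convex_sublevel]), and positivity of the distance is blow-up at the
    level [f p0], where the sublevel set contains [p0]. *)

Lemma enorm_continuous (R : realType) (n : nat) :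
  continuous (@enorm R n).
Proof.
move=> x; apply: (@continuous_comp _ _ _
  (fun y : 'rV[R]_n => \sum_(i < n) y 0 i ^+ 2) Num.sqrt).
  apply: (@cvg_big _ _ _ _ _ _ _ (nbhs x)) => [|i _].
    exact: add_continuous.
  apply: (@continuous_comp _ _ _ (fun y : 'rV[R]_n => y 0 i)
    (fun t : R => t ^+ 2)); first exact: coord_continuous.
  exact: exprn_continuous.
exact: sqrt_continuous.
Qed.

Lemma enorm0 (R : realType) (n : nat) : enorm (0 : 'rV[R]_n) = 0.
Proof.
by rewrite /enorm big1 ?sqrtr0 // => i _; rewrite mxE expr0n.
Qed.

(** The topology comes from the sup norm while [dist] is Euclidean; continuity
    of [enorm] makes the small Euclidean balls around a limit point of [A]
    neighbourhoods, so they meet [A]. *)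
Lemma closure_dist_gt0 (R : realType) (n : nat) (A B : set 'rV[R]_n) :
  (0 < dist A B)%E -> closure A `<=` ~` B.
Proof.
move=> AB_gt0 p clAp Bp.
suff : (dist A B <= 0)%E by rewrite leNgt AB_gt0.
apply/lee_addgt0Pr => e e_gt0; rewrite add0e.
have near_p : nbhs p [set a | enorm (a - p) < e].
  have cvg_p : enorm (a - p) @[a --> p] --> (0 : R).
    rewrite -(enorm0 R n) -(subrr p).
    apply: (@cvg_comp _ _ _ (fun a => a - p) (@enorm R n) _ (nbhs (p - p))).
      exact: (cvgB cvg_id (cvg_cst p)).
    exact: enorm_continuous.
  exact: (cvg_p _ (lt_nbhsl e_gt0)).
have [a [Aa /= ap_lt]] := clAp _ near_p.
apply: (@le_trans _ _ (enorm (a - p))%:E); last by rewrite lee_fin ltW.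
by apply: ereal_inf_lbound; exists a, p.
Qed.

Lemma closed_sublevel (R : realType) (n : nat) (C U : set 'rV[R]_n)
    (f : 'rV[R]_n -> R) (alpha : R) :
  closed C -> {in U, continuous f} ->
  (0 < dist (sublevel C U f alpha) (~` U))%E ->
  closed (sublevel C U f alpha).
Proof.
move=> C_closed f_cont dist_gt0 p clp.
have Up : U p by rewrite -(setCK U); exact: closure_dist_gt0 dist_gt0 _ clp.
have Cp : C p by apply: C_closed; apply: closureS clp => q [[]].
split=> //; rewrite leNgt; apply/negP => fp_gt.
have near_p : nbhs p [set q | alpha < f q].
  by apply: (f_cont p _ _ (lt_nbhsr fp_gt)); rewrite inE.
have [q [[_ fq_le] /= fq_gt]] := clp _ near_p.
by rewrite ltNge fq_le in fq_gt.
Qed.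

Lemma convex_sublevel (R : realType) (n : nat) (C U : set 'rV[R]_n)
    (f : 'rV[R]_n -> R) (alpha : R) :
  convex_set C -> convex_set U -> convex_function U f ->
  convex_set (sublevel C U f alpha).
Proof.
move=> C_convex U_convex f_convex x y t.
rewrite !inE => -[[Cx Ux] fx_le] [[Cy Uy] fy_le].
have Cxy := C_convex x y t (mem_set Cx) (mem_set Cy).
have Uxy := U_convex x y t (mem_set Ux) (mem_set Uy).
split; first by split; exact: set_mem.
apply: le_trans (f_convex t x y (mem_set Ux) (mem_set Uy)) _.
rewrite convRE -[leRHS](convmm t (alpha : R^o)) convRE.
by rewrite lerD // ler_wpM2l // subr_ge0 le1.
Qed.

Theorem lemma1 (R : realType) (n : nat) (C U : set 'rV[R]_n)
    (f : 'rV[R]_n -> R)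
    (C_neq0 : C !=set0) (C_compact : compact C) (C_convex : convex_set C)
    (U_open : open U) (U_convex : convex_set U)
    (CU_neq0 : C `&` U !=set0)
    (f_C2 : twice_continuously_differentiable U f)
    (f_convex : convex_function U f)
    (blow_up : forall alpha : R, sublevel C U f alpha !=set0 ->
      (0 < dist (sublevel C U f alpha) (~` U))%E)
    (p0 : 'rV[R]_n) (p0_in : (C `&` U) p0) :
  let F0 := sublevel C U f (f p0) in
  [/\ F0 !=set0, compact F0, convex_set F0 & (0 < dist F0 (~` U))%E].
Proof.
move=> F0.
have F0_neq0 : F0 !=set0 by exists p0; split.
have dist_gt0 := blow_up _ F0_neq0.
have f_cont : {in U, continuous f}.
  by move=> x /set_mem /f_C2[/differentiable_continuous].
have C_closed : closed C by apply: compact_closed => //; exact: norm_hausdorff.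
split=> //; last exact: convex_sublevel.
apply: subclosed_compact C_compact _; first exact: closed_sublevel.
by move=> p [[]].
Qed.
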